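(* Let two uniform-bidding advertisers have reported targets $T_1,T_2>0$ in a second-price auction with $n\ge1$ queries ordered so that $\frac{v_{1,1}}{v_{2,1}}>\frac{v_{1,2}}{v_{2,2}}>\dots>\frac{v_{1,n}}{v_{2,n}}$, and let $k\in\{0,1,\dots,n\}$. An auto-bidder equilibrium with allocation $N_k$ exists (equivalently, there exist $\mu_1,\mu_2$ satisfying all the inequalities (i)-(vi) listed in the context) if and only if all of the following four inequalities hold: $$\frac{T_1V_1(L_{k+1})}{T_2V_2(L_{k+1})}<\frac{v_{1,k}\cdot V_2(R_{k+1})}{v_{2,k}\cdot V_1(R_{k+1})},\qquad \frac{T_1V_1(R_k)}{T_2V_2(R_k)}>\frac{v_{1,k+1}\cdot V_2(L_k)}{v_{2,k+1}\cdot V_1(L_k)},$$ $$\frac{T_2V_2(R_{k+1})}{T_1V_1(R_{k+1})}\ge1,\qquad \frac{T_1V_1(L_k)}{T_2V_2(L_k)}\ge1.$$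
   Context: Setting. Two advertisers $1,2$, queries $1,\dots,n$, values $v_{i,j}>0$. With reported targets $T_1,T_2$, bidder $i$ uses one multiplier $\mu_i\ge1$ and bids $b_{i,j}=\mu_iT_iv_{i,j}$ on every query (uniform bidding). Each query is sold by a second-price auction: the higher bid wins (ties won by bidder 1) and the winner pays the other bidder's bid. Multipliers $\mu_1,\mu_2\ge1$ form an auto-bidder equilibrium if each bidder's total payment is at most $T_i$ times its total value won, and no bidder $i$ can, by switching to other uniform bids $\alpha' v_{i,j}$ ($\alpha'>0$) with the other bidder's bids unchanged, win strictly larger total value while still satisfying that constraint. $N_k$ is the allocation in which bidder 1 wins exactly queries $1,\dots,k$ and bidder 2 wins exactly $k+1,\dots,n$. Notation. Two virtual (not real) queries are added to handle boundary cases: $v_{1,0}=+\infty$, $v_{2,0}=1$, $v_{1,n+1}=1$, $v_{2,n+1}=+\infty$. $V_i(L_k)=\sum_{j=1}^kv_{i,j}$ and $V_i(R_k)=\sum_{j=k}^nv_{i,j}$ (so $V_i(R_0)$ includes query $0$ and $V_i(L_{n+1})$ includes query $n+1$, while $V_i(L_0)=V_i(R_{n+1})=0$). Boundary conventions: $a/\infty=0$ and $\infty/a=\infty$ for finite $a>0$; $\frac{V_1(L_0)}{V_2(L_0)}=+\infty$, $\frac{V_2(L_0)}{V_1(L_0)}=0$, $\frac{V_2(R_{n+1})}{V_1(R_{n+1})}=+\infty$, $\frac{V_1(R_{n+1})}{V_2(R_{n+1})}=0$; an expression $\frac{v_{1,a}V_2(X)}{v_{2,a}V_1(X)}$ means $\frac{v_{1,a}}{v_{2,a}}\cdot\frac{V_2(X)}{V_1(X)}$.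 Inequalities on the multipliers: (i) $\frac{T_1v_{1,k+1}}{T_2v_{2,k+1}}<\frac{\mu_2}{\mu_1}\le\frac{T_1v_{1,k}}{T_2v_{2,k}}$; (ii) $\mu_2T_2V_2(L_k)\le T_1V_1(L_k)$ (bidder 1 tCPA); (iii) $\mu_1T_1V_1(R_{k+1})\le T_2V_2(R_{k+1})$ (bidder 2 tCPA); (iv) $\mu_2T_2V_2(L_{k+1})>T_1V_1(L_{k+1})$ (bidder 1 stable); (v) $\mu_1T_1V_1(R_k)>T_2V_2(R_k)$ (bidder 2 stable); (vi) $\mu_1\ge1$, $\mu_2\ge1$. Existence of $\mu_1,\mu_2$ satisfying (i)-(vi) is the paper's characterization of the existence of an auto-bidder equilibrium with allocation $N_k$. *)

(* Defs.v *)
From HB Require Import structures.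
From mathcomp Require Import all_boot all_order all_algebra.
From mathcomp Require Import reals constructive_ereal.

Set Implicit Arguments.
Unset Strict Implicit.
Unset Printing Implicit Defensive.

Import Order.TTheory GRing.Theory Num.Theory.
Local Open Scope ring_scope.

(* The real queries are the elements of 'I_n: the ordinal i
   is the query that is numbered i + 1 in the usual 1-based numbering. *)

Section Auction.
Variables (R : realType) (n : nat).
Implicit Types (T mu a : R) (v b : 'I_n -> R) (S : {set 'I_n}).

Definition uniform_bids a v : 'I_n -> R := fun i => a * v i.

(* Ties are won by bidder 1, so the two definitions are not symmetric. *)
Definition won1 b1 b2 : {set 'I_n} := [set i | b2 i <= b1 i].
Definition won2 b1 b2 : {set 'I_n} := [set i | b1 i < b2 i].

Definition value v S : R := \sum_(i in S) v i.

(* Second price: the winner of S pays the other bidder's bids on S. *)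
Definition payment b_other S : R := \sum_(i in S) b_other i.

Definition tcpa T v b_other S : Prop := payment b_other S <= T * value v S.

Definition autobidder_equilibrium T1 T2 v1 v2 mu1 mu2 : Prop :=
  let b1 := uniform_bids (mu1 * T1) v1 in
  let b2 := uniform_bids (mu2 * T2) v2 in
  [/\ 1 <= mu1 /\ 1 <= mu2,
      tcpa T1 v1 b2 (won1 b1 b2),
      tcpa T2 v2 b1 (won2 b1 b2),
      ~ (exists a, let S := won1 (uniform_bids a v1) b2 in
           [/\ 0 < a, tcpa T1 v1 b2 S & value v1 (won1 b1 b2) < value v1 S]) &
      ~ (exists a, let S := won2 b1 (uniform_bids a v2) in
           [/\ 0 < a, tcpa T2 v2 b1 S & value v2 (won2 b1 b2) < value v2 S])].

(* Bidder 1 wins exactly the queries numbered 1, ..., k, and bidder 2 exactly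
   those numbered k + 1, ..., n. *)
Definition allocation_N k T1 T2 v1 v2 mu1 mu2 : Prop :=
  let b1 := uniform_bids (mu1 * T1) v1 in
  let b2 := uniform_bids (mu2 * T2) v2 in
  won1 b1 b2 = [set i : 'I_n | (i < k)%N] /\
  won2 b1 b2 = [set i : 'I_n | (k <= i)%N].

End Auction.

Section Inequalities.
Variables (R : realType) (n : nat).
Implicit Types (T mu : R) (v : 'I_n -> R) (x : nat -> \bar R).
Local Open Scope ereal_scope.

(* Values in the 1-based numbering, extended by x0 at the virtual query 0 and
   by xlast at the virtual query n + 1 (indices above n + 1 are never used). *)
Definition extend (x0 xlast : \bar R) v (j : nat) : \bar R :=
  if j is j'.+1 then
    (if insub j' is Some i then (v i)%:E else xlast)
  else x0.

Definition xv1 v := extend +oo 1 v.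
Definition xv2 v := extend 1 +oo v.

(* V(L_k) and V(R_k): L_{n+1} contains the virtual query n + 1 but not 0, and
   R_0 contains the virtual query 0 but not n + 1. *)
Definition VL x (k : nat) : \bar R := \sum_(1 <= j < k.+1) x j.
Definition VR x (k : nat) : \bar R := \sum_(k <= j < n.+1) x j.

(* The quotient x / y, with the value c assigned to 0 / 0 (in \bar R one has
   +oo^-1 = 0, and 0 / 0 would be 0).  It is needed for the ratios of the total
   values of the empty sets L_0 and R_{n+1}. *)
Definition quot_or (c x y : \bar R) : \bar R :=
  if (x == 0) && (y == 0) then c else x / y.

Definition multiplier_inequalities k T1 T2 v1 v2 mu1 mu2 : Prop :=
  let x1 := xv1 v1 in
  let x2 := xv2 v2 in
  [/\ (T1%:E * x1 k.+1) / (T2%:E * x2 k.+1) < (mu2 / mu1)%:E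
        <= (T1%:E * x1 k) / (T2%:E * x2 k),
      mu2%:E * T2%:E * VL x2 k <= T1%:E * VL x1 k /\
      mu1%:E * T1%:E * VR x1 k.+1 <= T2%:E * VR x2 k.+1,
      mu2%:E * T2%:E * VL x2 k.+1 > T1%:E * VL x1 k.+1,
      mu1%:E * T1%:E * VR x1 k > T2%:E * VR x2 k &
      (1 <= mu1)%R /\ (1 <= mu2)%R].

End Inequalities.

(* Main.v *)
(* With the virtual queries removed, (i)-(vi) confine mu1 to an interval (q, Q],
   mu2 to (p, P] and mu2 / mu1 to (l, u], besides mu1, mu2 >= 1.  The order of
   the queries alone gives p < P, q < Q, l < u, l < P and 1 <= u * Q, so the
   intervals are compatible iff p < u * Q, l * q < P, 1 <= Q and 1 <= P: these
   are the four inequalities.  If u * Q <= P one takes mu1 = Q, mu2 = u * Q, and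
   otherwise mu2 = P and mu1 <= Q large enough.  When k = 0 or k = n, one of the
   multipliers is unbounded above and is taken large.
   An allocation N_k is stable against deviations iff winning one more query is
   already too expensive, because any larger deviation only adds queries of a
   worse ratio of value to price. *)

Require Import Defs.
From HB Require Import structures.
From mathcomp Require Import all_boot all_order all_algebra.
From mathcomp Require Import reals constructive_ereal.
From Corelib Require Import Setoid Morphisms.
From mathcomp Require Import ring lra.

Set Implicit Arguments.
Unset Strict Implicit.
Unset Printing Implicit Defensive.

Import Order.TTheory GRing.Theory Num.Theory.
Local Open Scope ring_scope.

(** * Stability against uniform deviations, for one bidder *)

Section StabilityCriterion.
Variable R : realType.

(** The pivot [d i0] cannot be negative, since then no term over [S0] would be positive. Hence every
    term that [S] adds to [S0] is nonnegative. *)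
Lemma sum_setU_gt0 (I : finType) (d : I -> R) (i0 : I) (S0 S : {set I}) :
    S0 \subset S ->
    (forall i, i \in S0 -> d i0 <= 0 -> d i <= 0) ->
    (forall i, i \notin S0 -> 0 <= d i0 -> 0 <= d i) ->
  0 < \sum_(i in S0) d i -> 0 < \sum_(i in S) d i.
Proof.
move=> sub hin hout hS0.
have d0 : 0 <= d i0.
  rewrite leNgt; apply/negP => /ltW d0; move: hS0; apply/negP; rewrite -leNgt.
  by apply: sumr_le0 => i iS; apply: hin.
rewrite (bigID (mem S0)) /=.
have -> : \sum_(i in S | i \in S0) d i = \sum_(i in S0) d i.
  by apply: eq_bigl => i; rewrite andb_idl // => /(subsetP sub).
apply: ltr_wpDr hS0; apply: sumr_ge0 => i /andP[_ iS]; exact: hout.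
Qed.

Lemma le_value (n : nat) (v : 'I_n -> R) (S0 S : {set 'I_n}) :
  (forall i, 0 < v i) -> S0 \subset S -> value v S0 <= value v S.
Proof.
move=> hv sub; rewrite /value [leRHS](big_setID S0) /= (setIidPr sub) lerDl.
by apply: sumr_ge0 => j _; exact: ltW.
Qed.

(* [W a] is the set won with the uniform bids [a * v i] against the bids
   [c * w i].  A deviation winning more than [S0] wins at least [S1], which is
   [S0] with the next best query [i0] added, and all queries won beyond [S1]
   have an even worse ratio of value to price. *)
Lemma no_profitable_deviation (n : nat) (v w : 'I_n -> R) (T c : R)
    (W : R -> {set 'I_n}) (S0 S1 : {set 'I_n}) (i0 : 'I_n) :
    (forall i, 0 < v i) -> (forall i, 0 < w i) -> 0 < T -> 0 < c ->
    S1 = i0 |: S0 -> i0 \notin S0 ->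
    (forall i, i \in S0 -> v i0 / w i0 <= v i / w i) ->
    (forall i, i \notin S0 -> v i / w i <= v i0 / w i0) ->
    (forall a i j, 0 < a -> i \in W a -> v i / w i <= v j / w j -> j \in W a) ->
    (exists2 a, 0 < a & W a = S1) ->
  (~ exists a, let S := W a in
       [/\ 0 < a, tcpa T v (fun i => c * w i) S & value v S0 < value v S])
  <-> T * value v S1 < c * value w S1.
Proof.
move=> hv hw hT hc defS1 i0S0 hin hout hW [a0 a0_gt0 Wa0].
have sumE S : c * value w S - T * value v S = \sum_(i in S) (c * w i - T * v i).
  by rewrite sumrB /value !mulr_sumr.
have tcpaE S : tcpa T v (fun i => c * w i) S <-> c * value w S <= T * value v S.
  by rewrite /tcpa /payment -mulr_sumr.
(* The loss on query [i] has the sign of [c - T * (v i / w i)], so it depends monotonically on the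
   ratio of value to price. *)
have dE i : c * w i - T * v i = w i * (c - T * (v i / w i)).
  have := lt0r_neq0 (hw i); move=> ?; field => //.
split=> [nodev | hS1 [a] /= [a_gt0 /tcpaE hS hval]].
  rewrite ltNge; apply/negP => hle; apply: nodev; exists a0.
  rewrite Wa0; split => //; first exact/tcpaE.
  by rewrite defS1 /value big_setU1 //= ltrDr.
(* A set of larger value is not contained in [S0]. The query [i] outside [S0] forces [i0] to be won,
   and [i0] forces all of [S0]. *)
have [i iW iS0] : exists2 i, i \in W a & i \notin S0.
  apply/subsetPn; apply: contraTN hval => sub; rewrite -leNgt.
  exact: le_value.
have i0W : i0 \in W a by apply: hW iW _ => //; exact: hout.
have subW : S1 \subset W a.
  apply/subsetP => j; rewrite defS1 in_setU1 => /predU1P[->//|jS0].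
  by apply: hW i0W _ => //; exact: hin.
move: hS; apply/negP; rewrite -ltNge -subr_gt0 sumE.
apply: (@sum_setU_gt0 _ _ i0) subW _ _ _; last by rewrite -sumE subr_gt0.
- move=> j; rewrite defS1 in_setU1 => /predU1P[->//|/hin hj].
  rewrite !dE !pmulr_rle0 // !subr_le0 => /le_trans; apply.
  by rewrite ler_pM2l.
- move=> j; rewrite defS1 in_setU1 negb_or => /andP[_ /hout hj].
  rewrite !dE !pmulr_rge0 // !subr_ge0; apply: le_trans.
  by rewrite ler_pM2l.
Qed.

End StabilityCriterion.

(** * Initial and final segments of the queries, and their total values *)

Section LeftRight.
Variables (R : realType) (n : nat).
Implicit Types (v : 'I_n -> R) (k : nat).

Definition leftq k : {set 'I_n} := [set i : 'I_n | (i < k)%N].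
(** Ordinals count from 0, so [rightq k] is $R_{k+1}$ in the 1-based numbering, whereas [leftq k] is
    $L_k$. *)
Definition rightq k : {set 'I_n} := [set i : 'I_n | (k <= i)%N].

Lemma leftq0 : leftq 0 = set0.
Proof. by apply/setP => i; rewrite !inE. Qed.

Lemma rightqn : rightq n = set0.
Proof. by apply/setP => i; rewrite !inE leqNgt ltn_ord. Qed.

Lemma leftqS (i : 'I_n) : leftq i.+1 = i |: leftq i.
Proof. by apply/setP => j; rewrite !inE ltnS leq_eqVlt. Qed.

Lemma rightqS (i : 'I_n) : rightq i = i |: rightq i.+1.
Proof. by apply/setP => j; rewrite !inE leq_eqVlt eq_sym. Qed.

Lemma value_leftqS v (i : 'I_n) :
  value v (leftq i.+1) = value v (leftq i) + v i.
Proof. by rewrite leftqS /value big_setU1 ?inE ?ltnn //= addrC. Qed.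

Lemma value_rightqS v (i : 'I_n) :
  value v (rightq i) = v i + value v (rightq i.+1).
Proof. by rewrite rightqS /value big_setU1 ?inE ?ltnn. Qed.

Lemma value_set0 v : value v set0 = 0.
Proof. exact: big_set0. Qed.

Lemma value_gt0 v (S : {set 'I_n}) i :
  (forall i, 0 < v i) -> i \in S -> 0 < value v S.
Proof.
move=> hv iS; rewrite /value (bigD1 i) //=; apply: ltr_pwDl => //.
by apply: sumr_ge0 => j _; exact: ltW.
Qed.

Lemma extend_ord x0 xlast v (i : 'I_n) : extend x0 xlast v i.+1 = (v i)%:E.
Proof. by rewrite /= -[nat_of_ord i]/(val i) valK. Qed.

Lemma VL_leftq x0 xlast v k : (k <= n)%N ->
  VL (extend x0 xlast v) k = (value v (leftq k))%:E.
Proof.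
elim: k => [_|k IH hk]; first by rewrite leftq0 value_set0 /VL big_geq.
have [i ik] : {i : 'I_n | i = k :> nat} by exists (Ordinal hk).
rewrite /VL big_nat_recr // -/(VL _ k) IH 1?ltnW // -ik.
by rewrite extend_ord value_leftqS.
Qed.

Lemma VR_rightq x0 xlast v k : (k <= n)%N ->
  VR n (extend x0 xlast v) k.+1 = (value v (rightq k))%:E.
Proof.
(* The sum grows at its lower end, so the induction is on [n - k]. *)
move=> hk; rewrite -(subKn hk); elim: (n - k)%N (leq_subr k n) => [_|m IH hm].
  by rewrite subn0 rightqn value_set0 /VR big_geq.
have hi : (n - m.+1 < n)%N by rewrite ltn_subrL /= (leq_trans _ hm).
have [i im] : {i : 'I_n | i = n - m.+1 :> nat}%N by exists (Ordinal hi).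
have hS : (i.+1 = n - m)%N by rewrite im subnSK.
rewrite -im /VR big_ltn ?ltnS // -/(VR _ _ i.+2) hS IH 1?ltnW //.
by rewrite -hS extend_ord value_rightqS.
Qed.

Lemma extend_last x0 xlast v : extend x0 xlast v n.+1 = xlast.
Proof. by rewrite /= insubN // ltnn. Qed.

Lemma VL_last x0 xlast v :
  VL (extend x0 xlast v) n.+1 = ((value v (leftq n))%:E + xlast)%E.
Proof. by rewrite /VL big_nat_recr //= -/(VL _ _) VL_leftq // insubN ?ltnn. Qed.

Lemma VR0 x0 xlast v :
  VR n (extend x0 xlast v) 0 = (x0 + (value v (rightq 0))%:E)%E.
Proof. by rewrite /VR big_ltn // -/(VR _ _ _) VR_rightq. Qed.

End LeftRight.

(** * Equilibria with allocation $N_k$ as inequalities over the reals *)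

Section Equilibrium.
Variables (R : realType) (n : nat) (T1 T2 : R) (v1 v2 : 'I_n -> R) (k : nat).
Hypotheses (hk : (k <= n)%N) (hT1 : 0 < T1) (hT2 : 0 < T2).
Hypotheses (hv1 : forall i, 0 < v1 i) (hv2 : forall i, 0 < v2 i).
Hypothesis hord : forall i j : 'I_n, (i < j)%N -> v1 j / v2 j < v1 i / v2 i.

(* The inequalities (i)-(vi) over the reals: an inequality that mentions a
   virtual query is replaced by a vacuous quantification over the ordinals. *)
Definition real_inequalities (mu1 mu2 : R) : Prop :=
  [/\ (forall i : 'I_n, i = k :> nat -> mu1 * T1 * v1 i < mu2 * T2 * v2 i) /\
      (forall i : 'I_n, i.+1 = k -> mu2 * T2 * v2 i <= mu1 * T1 * v1 i),
      mu2 * T2 * value v2 (leftq n k) <= T1 * value v1 (leftq n k) /\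
      mu1 * T1 * value v1 (rightq n k) <= T2 * value v2 (rightq n k),
      (forall i : 'I_n, i = k :> nat ->
         T1 * value v1 (leftq n i.+1) < mu2 * T2 * value v2 (leftq n i.+1)),
      (forall i : 'I_n, i.+1 = k ->
         T2 * value v2 (rightq n i) < mu1 * T1 * value v1 (rightq n i)) &
      1 <= mu1 /\ 1 <= mu2].

Lemma ratio12_le (i j : 'I_n) : (i <= j)%N -> v1 j / v2 j <= v1 i / v2 i.
Proof. by rewrite leq_eqVlt => /predU1P[/val_inj -> //|/hord/ltW]. Qed.

Lemma ratio21_lt (i j : 'I_n) : (i < j)%N -> v2 i / v1 i < v2 j / v1 j.
Proof.
by move/hord; rewrite -ltf_pV2 ?posrE ?divr_gt0 // !invf_div.
Qed.

Lemma ratio21_le (i j : 'I_n) : (i <= j)%N -> v2 i / v1 i <= v2 j / v1 j.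
Proof. by rewrite leq_eqVlt => /predU1P[/val_inj -> //|/ratio21_lt/ltW]. Qed.

(** Bidder 1 wins a query iff its ratio [v1 i / v2 i] reaches a fixed threshold. The ratios
    decrease, so only the two queries next to the cut need to be compared with it. *)
Lemma allocation_N_real mu1 mu2 : 0 < mu1 -> 0 < mu2 ->
  allocation_N k T1 T2 v1 v2 mu1 mu2 <->
  (forall i : 'I_n, i = k :> nat -> mu1 * T1 * v1 i < mu2 * T2 * v2 i) /\
  (forall i : 'I_n, i.+1 = k -> mu2 * T2 * v2 i <= mu1 * T1 * v1 i).
Proof.
move=> hm1 hm2; have c1 : 0 < mu1 * T1 by apply: mulr_gt0.
have c2 : 0 < mu2 * T2 by apply: mulr_gt0.
have bidE i : (mu2 * T2 * v2 i <= mu1 * T1 * v1 i)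
    = (mu2 * T2 / (mu1 * T1) <= v1 i / v2 i).
  by rewrite ler_pdivrMr // [_ / _ * _]mulrAC ler_pdivlMr // [v1 i * _]mulrC.
split=> [[/setP h1 /setP h2]|[h1 h2]].
  split=> i ik.
  - by have := h2 i; rewrite !inE -ik leqnn.
  - by have := h1 i; rewrite !inE -ik ltnSn.
have won i : (mu2 * T2 * v2 i <= mu1 * T1 * v1 i) = (i < k)%N.
  case: (ltnP i k) => [ik|ki].
    have hj : (k.-1 < n)%N by rewrite prednK ?(leq_ltn_trans _ ik).
    have jk : (Ordinal hj).+1 = k by rewrite /= prednK ?(leq_ltn_trans _ ik).
    rewrite bidE; move: (h2 _ jk); rewrite bidE => /le_trans; apply.
    by apply: ratio12_le; rewrite -ltnS jk.
  have kn : (k < n)%N := leq_ltn_trans ki (ltn_ord i).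
  apply/negbTE; rewrite bidE -ltNge.
  have h := h1 (Ordinal kn) erefl; rewrite ltNge bidE -ltNge in h.
  by apply: le_lt_trans h; exact: ratio12_le.
by split; apply/setP => i; rewrite !inE /uniform_bids ?ltNge won // -leqNgt.
Qed.

(** The next best query for bidder 1 is the ordinal [k]. If [k = n], bidder 1 already wins
    everything and both sides hold. *)
Lemma no_deviation1 (c2 : R) : 0 < c2 ->
  (~ exists a, let S := won1 (uniform_bids a v1) (uniform_bids c2 v2) in
       [/\ 0 < a, tcpa T1 v1 (uniform_bids c2 v2) S &
           value v1 (leftq n k) < value v1 S])
  <-> (forall i : 'I_n, i = k :> nat ->
         T1 * value v1 (leftq n i.+1) < c2 * value v2 (leftq n i.+1)).
Proof.
move=> hc; have [kn|nk] := ltnP k n; last first.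
  split=> [_ i ik|_ [a [_ _]]].
    by move: (ltn_ord i); rewrite ik ltnNge nk.
  apply/negP; rewrite -leNgt; apply: le_value => //.
  by apply/subsetP => i _; rewrite inE (leq_trans (ltn_ord i)).
pose i0 := Ordinal kn.
have bidE a i : (c2 * v2 i <= a * v1 i) = (c2 <= a * (v1 i / v2 i)).
  by rewrite mulrA ler_pdivlMr.
have := @no_profitable_deviation _ n v1 v2 T1 c2
  (fun a => won1 (uniform_bids a v1) (uniform_bids c2 v2)) (leftq n k)
  (leftq n i0.+1) i0 hv1 hv2 hT1 hc (leftqS i0).
rewrite inE ltnn => /(_ isT) h.
apply: (iff_trans (h _ _ _ _)) => {h}.
- by move=> i; rewrite inE => /ltnW; exact: (@ratio12_le _ i0).
- by move=> i; rewrite inE -leqNgt; exact: (@ratio12_le i0).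
- move=> a i j a_gt0; rewrite !inE /uniform_bids !bidE => /le_trans h hij.
  by apply: h; rewrite ler_pM2l.
(* This scale ties on [i0], and bidder 1 wins ties, so exactly the ordinals up to [i0] are won. *)
- exists (c2 / (v1 i0 / v2 i0)); first by rewrite !divr_gt0.
  apply/setP => i; rewrite !inE /uniform_bids bidE mulrAC.
  rewrite ler_pdivlMr ?divr_gt0 // ler_pM2l // ltnS.
  case: leqP => [/ratio12_le //|/hord]; by rewrite ltNge => /negbTE.
- by split=> [h i ik|]; [rewrite ik | apply].
Qed.

(** The order is reversed for bidder 2, whose next best query is the ordinal [k.-1]. Bidder 2 loses
    ties, so the bid that wins exactly one more query is chosen differently than for bidder 1. *)
Lemma no_deviation2 (c1 : R) : 0 < c1 ->
  (~ exists a, let S := won2 (uniform_bids c1 v1) (uniform_bids a v2) in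
       [/\ 0 < a, tcpa T2 v2 (uniform_bids c1 v1) S &
           value v2 (rightq n k) < value v2 S])
  <-> (forall i : 'I_n, i.+1 = k ->
         T2 * value v2 (rightq n i) < c1 * value v1 (rightq n i)).
Proof.
move=> hc; case: (posnP k) => [k0|k0].
  split=> [_ i|_ [a [_ _]]]; first by rewrite k0.
  apply/negP; rewrite -leNgt k0; apply: le_value => //.
  by apply/subsetP => i _; rewrite inE.
have kn : (k.-1 < n)%N by rewrite prednK.
pose i0 := Ordinal kn; have i0k : i0.+1 = k by rewrite /= prednK.
have bidE a i : (c1 * v1 i < a * v2 i) = (c1 < a * (v2 i / v1 i)).
  by rewrite mulrA ltr_pdivlMr.
have := @no_profitable_deviation _ n v2 v1 T2 c1
  (fun a => won2 (uniform_bids c1 v1) (uniform_bids a v2)) (rightq n i0.+1)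
  (rightq n i0) i0 hv2 hv1 hT2 hc (rightqS i0).
rewrite inE ltnn i0k => /(_ isT) h.
apply: (iff_trans (h _ _ _ _)) => {h}.
- by move=> i; rewrite inE -i0k => /ltnW; exact: (@ratio21_le i0).
- by move=> i; rewrite inE -i0k -leqNgt; exact: (@ratio21_le _ i0).
- move=> a i j a_gt0; rewrite !inE /uniform_bids !bidE => /lt_le_trans h hij.
  by apply: h; rewrite ler_pM2l.
- have [i00|i00] := posnP i0.
    (* All queries are to be won, so it is enough to exceed the tie on [i0]; the factor 2 makes this
       strict. *)
    exists (2 * c1 / (v2 i0 / v1 i0)); first by rewrite !divr_gt0 ?mulr_gt0.
    apply/setP => i; rewrite !inE /uniform_bids bidE i00 leq0n mulrAC.
    rewrite ltr_pdivlMr ?divr_gt0 //.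
    have h : v2 i0 / v1 i0 <= v2 i / v1 i by apply: ratio21_le; rewrite i00.
    apply: (@lt_le_trans _ _ (2 * c1 * (v2 i0 / v1 i0))); last first.
      by rewrite ler_pM2l ?mulr_gt0.
    by rewrite ltr_pM2r ?divr_gt0 // ltr_pMl ?ltr1n.
  (* Bid so as to tie on the query [j] just below [i0], which is then lost. *)
  have hj : (i0.-1 < n)%N by rewrite (leq_ltn_trans (leq_pred _)).
  pose j := Ordinal hj; have ji0 : j.+1 = i0 by rewrite /= prednK.
  exists (c1 / (v2 j / v1 j)); first by rewrite !divr_gt0.
  apply/setP => i; rewrite !inE /uniform_bids bidE mulrAC.
  rewrite ltr_pdivlMr ?divr_gt0 // ltr_pM2l // -ji0.
  case: ltnP => [/ratio21_lt //|/ratio21_le]; by rewrite leNgt => /negbTE.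
- split=> [h i ik|]; last by apply.
  by have -> : i = i0 by apply/val_inj/succn_inj; rewrite /= ik prednK.
Qed.

Lemma equilibrium_real mu1 mu2 :
  autobidder_equilibrium T1 T2 v1 v2 mu1 mu2 /\
  allocation_N k T1 T2 v1 v2 mu1 mu2 <-> real_inequalities mu1 mu2.
Proof.
(* Both sides contain these bounds, so they may be assumed; they supply the positivity that the
   lemmas on allocations and deviations require. *)
have [hm|hm] : 1 <= mu1 /\ 1 <= mu2 \/ ~ (1 <= mu1 /\ 1 <= mu2).
- by case: (lerP 1 mu1) => ?; case: (lerP 1 mu2) => ?; [left|right => -[]..].
- have [m1 m2] : 0 < mu1 /\ 0 < mu2.
    by case: hm => m1 m2; split; exact: lt_le_trans ltr01 _.
  have hA := allocation_N_real m1 m2.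
  have hD1 := no_deviation1 (mulr_gt0 m2 hT2).
  have hD2 := no_deviation2 (mulr_gt0 m1 hT1).
  have tcpaE T c (v w : 'I_n -> R) S :
      tcpa T v (uniform_bids c w) S <-> c * value w S <= T * value v S.
    by rewrite /tcpa /payment -mulr_sumr.
  split=> [[[_ p1 p2 s1 s2] al]|[h1 [p1 p2] s1 s2 _]].
    have h1 := hA.1 al; case: al => al1 al2.
    rewrite al1 in p1 s1; rewrite al2 in p2 s2.
    by split => //; [split; exact/tcpaE | exact: hD1.1 | exact: hD2.1].
  have al := hA.2 h1; split=> //; case: al => al1 al2.
  split => //; rewrite ?al1 ?al2;
    [exact/tcpaE | exact/tcpaE | exact: hD1.2 | exact: hD2.2].
- by split=> [[[]]|[]].
Qed.

End Equilibrium.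

(** * Compatibility of the intervals for the multipliers and their ratio *)

(** One multiplier can always be put at its upper bound: [m1 = Q] if [u * Q <= P], and [m2 = P]
    otherwise. *)
Lemma multipliers_exist (R : realType) (l u p P q Q : R) :
    0 < l -> 0 < u -> 1 <= P -> 1 <= Q -> p < P -> q < Q ->
    l < u -> l < P -> l * q < P -> p < u * Q -> 1 <= u * Q ->
  exists m1 m2, [/\ 1 <= m1 <= Q, 1 <= m2 <= P, q < m1, p < m2 &
                    l * m1 < m2 <= u * m1].
Proof.
move=> l0 u0 P1 Q1 pP qQ lu lP lqP puQ uQ1.
have Q0 : 0 < Q by apply: lt_le_trans ltr01 Q1.
have [uQP|PuQ] := lerP (u * Q) P.
  by exists Q, (u * Q); rewrite Q1 lexx uQ1 uQP lexx ltr_pM2r // lu.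
(* With [m2 = P], the constraints on [m1] are [1 <= m1], [P / u <= m1], [q < m1], [m1 <= Q] and
   [m1 < P / l]. Only the lower bound [q] is strict, so the midpoint [e] replaces it in the
   maximum. *)
have qm : q < Num.min Q (P / l) by rewrite lt_min qQ ltr_pdivlMr // mulrC.
have [] := midf_lt qm; set e := (_ / _) => qe.
rewrite lt_min => /andP[eQ]; rewrite ltr_pdivlMr // => el.
exists (Num.max (Num.max 1 (P / u)) e), P; split=> //.
- rewrite !le_max lexx !ge_max Q1 ler_pdivrMr // [Q * u]mulrC.
  by rewrite (ltW PuQ) (ltW eQ).
- by rewrite P1 lexx.
- by rewrite !lt_max qe !orbT.
- rewrite mulrC -ltr_pdivlMr // !gt_max ltr_pdivlMr // mul1r lP.
  rewrite [e < _]ltr_pdivlMr // el ltr_pM2l ?(lt_le_trans ltr01) //.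
  rewrite ltf_pV2 ?posrE // lu /=.
  by rewrite mulrC -ler_pdivrMr // !le_max lexx !orbT.
Qed.

(** The case where queries $k$ and $k+1$ are both real. For bidders 1 and 2 respectively, [a], [b]
    are the values of query $k$, [a'], [b'] those of query $k+1$, [A], [B] the totals on $L_k$ and
    [C], [D] those on $R_{k+1}$. The last two hypotheses say that query $k$ has a ratio at most that
    of $L_k$, and query $k+1$ one at least that of $R_{k+1}$. *)
Lemma interior_multipliers (R : realType) (T1 T2 a b a' b' A B C D : R) :
    0 < T1 -> 0 < T2 -> 0 < a -> 0 < b -> 0 < a' -> 0 < b' ->
    0 < A -> 0 < B -> 0 < C -> 0 < D ->
    a' * b < a * b' -> a * B <= A * b -> C * b' <= a' * D ->
  (exists mu1 mu2,
     [/\ mu1 * T1 * a' < mu2 * T2 * b' /\ mu2 * T2 * b <= mu1 * T1 * a,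
         mu2 * T2 * B <= T1 * A /\ mu1 * T1 * C <= T2 * D,
         T1 * (A + a') < mu2 * T2 * (B + b'),
         T2 * (b + D) < mu1 * T1 * (a + C) &
         1 <= mu1 /\ 1 <= mu2])
  <->
  [/\ T1 * (A + a') / (T2 * (B + b')) < a / b * (D / C),
      a' / b' * (B / A) < T1 * (a + C) / (T2 * (b + D)),
      1 <= T2 / T1 * (D / C) &
      1 <= T1 / T2 * (A / B)].
Proof.
move=> T10 T20 a0 b0 a'0 b'0 A0 B0 C0 D0 hab hAB hCD.
have Bb0 : 0 < B + b' by apply: addr_gt0.
have bD0 : 0 < b + D by apply: addr_gt0.
have Aa0 : 0 < A + a' by apply: addr_gt0.
have aC0 : 0 < a + C by apply: addr_gt0.
pose l := T1 * a' / (T2 * b'); pose u := T1 * a / (T2 * b).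
pose p := T1 * (A + a') / (T2 * (B + b')); pose P := T1 * A / (T2 * B).
pose q := T2 * (b + D) / (T1 * (a + C)); pose Q := T2 * D / (T1 * C).
have [l0 u0 p0 P0] : [/\ 0 < l, 0 < u, 0 < p & 0 < P].
  by split; rewrite divr_gt0 ?mulr_gt0.
have [q0 Q0] : 0 < q /\ 0 < Q by split; rewrite divr_gt0 ?mulr_gt0.
have lE m1 m2 : (m1 * T1 * a' < m2 * T2 * b') = (l * m1 < m2).
  rewrite -[RHS](ltr_pM2r (mulr_gt0 T20 b'0)) /l.
  by congr (_ < _); field; rewrite ?gt_eqF.
have uE m1 m2 : (m2 * T2 * b <= m1 * T1 * a) = (m2 <= u * m1).
  rewrite -[RHS](ler_pM2r (mulr_gt0 T20 b0)) /u.
  by congr (_ <= _); field; rewrite ?gt_eqF.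
have PE m2 : (m2 * T2 * B <= T1 * A) = (m2 <= P).
  by rewrite ler_pdivlMr ?mulr_gt0 // mulrA.
have QE m1 : (m1 * T1 * C <= T2 * D) = (m1 <= Q).
  by rewrite ler_pdivlMr ?mulr_gt0 // mulrA.
have pE m2 : (T1 * (A + a') < m2 * T2 * (B + b')) = (p < m2).
  by rewrite ltr_pdivrMr ?mulr_gt0 // mulrA.
have qE m1 : (T2 * (b + D) < m1 * T1 * (a + C)) = (q < m1).
  by rewrite ltr_pdivrMr ?mulr_gt0 // mulrA.
have -> : a / b * (D / C) = u * Q.
  by rewrite /u /Q; field; rewrite ?gt_eqF.
have -> : a' / b' * (B / A) = l / P.
  by rewrite /l /P; field; rewrite ?gt_eqF.
have -> : T1 * (a + C) / (T2 * (b + D)) = 1 / q.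
  by rewrite div1r invf_div.
have -> : T2 / T1 * (D / C) = Q.
  by rewrite /Q; field; rewrite ?gt_eqF.
have -> : T1 / T2 * (A / B) = P.
  by rewrite /P; field; rewrite ?gt_eqF.
have -> : (l / P < 1 / q) = (l * q < P).
  by rewrite ltr_pdivlMr // mulrAC ltr_pdivrMr // mul1r.
rewrite -/p.
split=> [[m1 [m2 []]]|[puQ lqP Q1 P1]].
  (* Chain the bounds: [p < m2 <= u * m1 <= u * Q] and [l * q < l * m1 < m2 <= P]. *)
  rewrite lE uE PE QE pE qE => -[lm mu] [m2P m1Q] pm qm [m11 m21]; split.
  - apply: (lt_le_trans pm); apply: (le_trans mu); by rewrite ler_pM2l.
  - by apply: lt_le_trans m2P; apply: lt_trans lm; rewrite ltr_pM2l.
  - exact: le_trans m1Q.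
  - exact: le_trans m21 _.
(* Now [a' / b' < A / B] and [C / D < a / b]. The first gives [l < P] and the second [1 <= u * Q];
   by the mediant inequality they also give [p < P] and [q < Q]. *)
have hA : a' * B < A * b'.
  rewrite -(ltr_pM2r b0) [ltLHS]mulrAC [ltRHS]mulrAC.
  apply: (@lt_le_trans _ _ (a * b' * B)); first by rewrite ltr_pM2r.
  by rewrite [leLHS]mulrAC ler_pM2r.
have hC : C * b < a * D.
  rewrite -(ltr_pM2r b'0) [ltLHS]mulrAC.
  apply: (@le_lt_trans _ _ (a' * D * b)); first by rewrite ler_pM2r.
  by rewrite [ltLHS]mulrAC [ltRHS]mulrAC ltr_pM2r.
have lu : l < u.
  rewrite /l /u ltr_pdivrMr ?mulr_gt0 // mulrAC ltr_pdivlMr ?mulr_gt0 //.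
  by rewrite mulrACA [ltRHS]mulrACA ltr_pM2l ?mulr_gt0.
have lP : l < P.
  rewrite /l /P ltr_pdivrMr ?mulr_gt0 // mulrAC ltr_pdivlMr ?mulr_gt0 //.
  by rewrite mulrACA [ltRHS]mulrACA ltr_pM2l ?mulr_gt0.
have pP : p < P.
  rewrite /p /P ltr_pdivrMr ?mulr_gt0 // mulrAC ltr_pdivlMr ?mulr_gt0 //.
  rewrite mulrACA [ltRHS]mulrACA ltr_pM2l ?mulr_gt0 //; lra.
have qQ : q < Q.
  rewrite /q /Q ltr_pdivrMr ?mulr_gt0 // mulrAC ltr_pdivlMr ?mulr_gt0 //.
  rewrite mulrACA [ltRHS]mulrACA ltr_pM2l ?mulr_gt0 //; lra.
have uQ1 : 1 <= u * Q.
  have -> : u * Q = a * D / (b * C) by rewrite /u /Q; field; rewrite ?gt_eqF.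
  by rewrite ler_pdivlMr ?mulr_gt0 // mul1r mulrC ltW.
have [m1 [m2 [/andP[m11 m1Q] /andP[m21 m2P] qm pm /andP[lm mu]]]] :=
  multipliers_exist l0 u0 P1 Q1 pP qQ lu lP lqP puQ uQ1.
by exists m1, m2; rewrite lE uE PE QE pE qE.
Qed.

(** Allows rewriting with equivalences such as [forall_val_eq] inside a five-fold conjunction. *)
#[local] Instance and5_iff_proper :
  Proper (iff ==> iff ==> iff ==> iff ==> iff ==> iff) and5.
Proof.
move=> a a' ha b b' hb c c' hc d d' hd e e' he.
by split=> -[/ha ? /hb ? /hc ? /hd ? /he ?].
Qed.

(** * Elimination of the virtual queries and of infinite values *)

Section ExtendedReals.
Variables (R : realType) (n : nat) (T1 T2 : R) (v1 v2 : 'I_n -> R) (k : nat).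
Hypotheses (hn : (1 <= n)%N) (hk : (k <= n)%N).
Hypotheses (hT1 : 0 < T1) (hT2 : 0 < T2).
Hypotheses (hv1 : forall i, 0 < v1 i) (hv2 : forall i, 0 < v2 i).
Hypothesis hord : forall i j : 'I_n, (i < j)%N -> v1 j / v2 j < v1 i / v2 i.

Lemma EFin_div (x y : R) : 0 < y -> (x%:E / y%:E)%E = (x / y)%:E.
Proof. by move=> hy; rewrite inver gt_eqF. Qed.

Lemma fin_mul_pinfty (x : R) : 0 < x -> (x%:E * +oo)%E = +oo%E.
Proof. by move=> hx; rewrite gt0_muley ?lte_fin. Qed.

Lemma pinfty_mul_fin (x : R) : 0 < x -> (+oo * x%:E)%E = +oo%E.
Proof. by move=> hx; rewrite gt0_mulye ?lte_fin. Qed.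

Lemma pinfty_div_fin (x : R) : 0 < x -> (+oo / x%:E)%E = +oo%E.
Proof. by move=> hx; rewrite inver gt_eqF // pinfty_mul_fin ?invr_gt0. Qed.

(** Since [1 <= n], at most one of the queries $k$ and $k+1$ is virtual. The ordinals [i] and [j]
    stand for queries $k$ and $k+1$ when these are real. *)
Variant query_position : Prop :=
| QueryFirst (j : 'I_n) of j = k :> nat & k = 0%N
| QueryLast (i : 'I_n) of i.+1 = k & k = n
| QueryMiddle (i j : 'I_n) of i.+1 = k & j = k :> nat.

Lemma query_positionP : query_position.
Proof.
have [k0|k0] := posnP k; first exact: (@QueryFirst (Ordinal hn)).
have hi : (k.-1 < n)%N by rewrite prednK.
move: hk; rewrite leq_eqVlt => /predU1P[kn|kn].
  by apply: (@QueryLast (Ordinal hi)); rewrite /= ?prednK.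
by apply: (@QueryMiddle (Ordinal hi) (Ordinal kn)); rewrite /= ?prednK.
Qed.

Lemma forall_val_eq (P : 'I_n -> Prop) (j : 'I_n) : j = k :> nat ->
  (forall i : 'I_n, i = k :> nat -> P i) <-> P j.
Proof. by move=> jk; split=> [|Pj i]; [apply | rewrite -jk => /val_inj ->]. Qed.

Lemma forall_succ_eq (P : 'I_n -> Prop) (j : 'I_n) : j.+1 = k ->
  (forall i : 'I_n, i.+1 = k -> P i) <-> P j.
Proof.
by move=> jk; split=> [|Pj i]; [apply | rewrite -jk => -[/val_inj ->]].
Qed.

Lemma forall_val_eqn (P : 'I_n -> Prop) : k = n ->
  (forall i : 'I_n, i = k :> nat -> P i) <-> True.
Proof.
by move=> kn; split=> // _ i ik; have := ltn_ord i; rewrite ik kn ltnn.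
Qed.

Lemma forall_succ_eq0 (P : 'I_n -> Prop) : k = 0%N ->
  (forall i : 'I_n, i.+1 = k -> P i) <-> True.
Proof. by move=> k0; split=> // _ i; rewrite k0. Qed.

Lemma extend_val (x0 xlast : \bar R) v (j : 'I_n) : j = k :> nat ->
  extend x0 xlast v k.+1 = (v j)%:E.
Proof. by move=> <-; rewrite extend_ord. Qed.

Lemma extend_succ (x0 xlast : \bar R) v (i : 'I_n) : i.+1 = k ->
  extend x0 xlast v k = (v i)%:E.
Proof. by move=> <-; rewrite extend_ord. Qed.

Lemma VL_val (x0 xlast : \bar R) v (j : 'I_n) : j = k :> nat ->
  VL (extend x0 xlast v) k.+1 = (value v (leftq n j.+1))%:E.
Proof. by move=> <-; rewrite VL_leftq. Qed.

Lemma VR_succ (x0 xlast : \bar R) v (i : 'I_n) : i.+1 = k ->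
  VR n (extend x0 xlast v) k = (value v (rightq n i))%:E.
Proof. by move=> <-; rewrite VR_rightq // ltnW. Qed.

(** For [k = 0] the upper bound in (i) and the left side of (v) are infinite. For [k = n] the lower
    bound in (i) is 0 and the left side of (iv) is infinite. These inequalities then hold, matching
    the vacuous quantifications. *)
Lemma multiplier_real mu1 mu2 :
  multiplier_inequalities k T1 T2 v1 v2 mu1 mu2 <->
  real_inequalities T1 T2 v1 v2 k mu1 mu2.
Proof.
have [hm|hm] : 1 <= mu1 /\ 1 <= mu2 \/ ~ (1 <= mu1 /\ 1 <= mu2).
- by case: (lerP 1 mu1) => ?; case: (lerP 1 mu2) => ?; [left|right => -[]..].
- have [m1 m2] : 0 < mu1 /\ 0 < mu2.
    by case: hm => m1 m2; split; exact: lt_le_trans ltr01 _.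
  have ltE (i : 'I_n) :
      ((T1%:E * (v1 i)%:E) / (T2%:E * (v2 i)%:E) < (mu2 / mu1)%:E)%E =
      (mu1 * T1 * v1 i < mu2 * T2 * v2 i).
    rewrite -!EFinM EFin_div ?mulr_gt0 // lte_fin ltr_pdivrMr ?mulr_gt0 //.
    by rewrite [_ / _ * _]mulrAC ltr_pdivlMr // [X in (X < _)%R]mulrC !mulrA.
  have leE (i : 'I_n) :
      ((mu2 / mu1)%:E <= (T1%:E * (v1 i)%:E) / (T2%:E * (v2 i)%:E))%E =
      (mu2 * T2 * v2 i <= mu1 * T1 * v1 i).
    rewrite -!EFinM EFin_div ?mulr_gt0 // lee_fin ler_pdivlMr ?mulr_gt0 //.
    by rewrite [_ / _ * _]mulrAC ler_pdivrMr // [X in (_ <= X)%R]mulrC !mulrA.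
  have hm2T2 : 0 < mu2 * T2 by apply: mulr_gt0.
  have hm1T1 : 0 < mu1 * T1 by apply: mulr_gt0.
  rewrite /multiplier_inequalities /real_inequalities /xv1 /xv2.
  rewrite !(VL_leftq _ _ _ hk) !(VR_rightq _ _ _ hk) -!EFinM !lee_fin.
  case: query_positionP => [j jk k0|i ik kn|i j ik jk].
  + rewrite !(forall_val_eq _ jk) !(forall_succ_eq0 _ k0).
    rewrite !(extend_val _ _ _ jk) !(VL_val _ _ _ jk) ltE k0 !VR0 /=.
    rewrite inver mulr1 gt_eqF // fin_mul_pinfty // pinfty_mul_fin ?invr_gt0 //.
    rewrite addye // fin_mul_pinfty // leey andbT -!EFinD -!EFinM !lte_fin ltry.
    by split=> [[h1 h2 h3 h4 h5]|[[h1 _] h2 h3 _ h5]]; split.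
  + rewrite !(forall_succ_eq _ ik) !(forall_val_eqn _ kn).
    rewrite !(extend_succ _ _ _ ik) !(VR_succ _ _ _ ik) leE kn.
    rewrite !extend_last !VL_last.
    rewrite fin_mul_pinfty // invey mule0 lte_fin divr_gt0 //= addey //.
    rewrite fin_mul_pinfty // -EFinD -!EFinM !lte_fin ltry.
    by split=> [[h1 h2 h3 h4 h5]|[[_ h1] h2 _ h4 h5]]; split.
  + rewrite !(forall_succ_eq _ ik) !(forall_val_eq _ jk).
    rewrite !(extend_succ _ _ _ ik) !(VR_succ _ _ _ ik).
    rewrite !(extend_val _ _ _ jk) !(VL_val _ _ _ jk) leE ltE.
    rewrite -!EFinM !lte_fin.
    by split=> [[/andP[? ?] h2 h3 h4 h5]|[[h0 h1] h2 h3 h4 h5]];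
      split; rewrite ?h0.
- by split=> [[_ _ _ _ []]|[_ _ _ _ []]] *; case: hm.
Qed.

(** Written exactly as in the final theorem, so that the two agree by conversion. *)
Definition four_inequalities : Prop :=
  let x1 := xv1 v1 in
  let x2 := xv2 v2 in
  [/\ (T1%:E * VL x1 k.+1) / (T2%:E * VL x2 k.+1)
        < (x1 k / x2 k) * quot_or +oo (VR n x2 k.+1) (VR n x1 k.+1),
      (T1%:E * VR n x1 k) / (T2%:E * VR n x2 k)
        > (x1 k.+1 / x2 k.+1) * quot_or 0 (VL x2 k) (VL x1 k),
      (T2 / T1)%:E * quot_or +oo (VR n x2 k.+1) (VR n x1 k.+1) >= 1 &
      (T1 / T2)%:E * quot_or +oo (VL x1 k) (VL x2 k) >= 1]%E.

Lemma quot_or_fin (c : \bar R) (x y : R) : 0 < x -> 0 < y ->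
  quot_or c x%:E y%:E = (x / y)%:E.
Proof. by move=> hx hy; rewrite /quot_or eqe gt_eqF //= EFin_div. Qed.

Lemma quot_or00 (c : \bar R) : quot_or c 0%:E 0%:E = c.
Proof. by rewrite /quot_or eqxx. Qed.

(** At [k = 0] or [k = n] one bidder wins everything, and the boundary conventions make three of the
    four inequalities true. The remaining one is the tCPA constraint of that bidder when the other
    has multiplier 1. *)
Lemma exists_real_four :
  (exists mu1 mu2, real_inequalities T1 T2 v1 v2 k mu1 mu2) <->
  four_inequalities.
Proof.
have hT21 : 0 < T2 / T1 by apply: divr_gt0.
have hT12 : 0 < T1 / T2 by apply: divr_gt0.
rewrite /four_inequalities /real_inequalities /xv1 /xv2.
rewrite !(VL_leftq _ _ _ hk) !(VR_rightq _ _ _ hk).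
case: query_positionP => [j jk k0|i ik kn|i j ik jk].
- have C0 : 0 < value v1 (rightq n k)
    by apply: (@value_gt0 _ _ _ _ j); rewrite // inE jk.
  have D0 : 0 < value v2 (rightq n k)
    by apply: (@value_gt0 _ _ _ _ j); rewrite // inE jk.
  have A0 : 0 < value v1 (leftq n j.+1)
    by apply: (@value_gt0 _ _ _ _ j); rewrite // inE.
  have B0 : 0 < value v2 (leftq n j.+1)
    by apply: (@value_gt0 _ _ _ _ j); rewrite // inE.
  rewrite !(extend_val _ _ _ jk) !(VL_val _ _ _ jk).
  have VRk (x0 xlast : \bar R) v :
      VR n (extend x0 xlast v) k = (x0 + (value v (rightq n k))%:E)%E.
    by rewrite k0 VR0.
  have xk (x0 xlast : \bar R) (v : 'I_n -> R) : extend x0 xlast v k = x0.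
    by rewrite k0.
  have Vk v : value v (leftq n k) = 0 by rewrite k0 leftq0 value_set0.
  rewrite !VRk !xk !Vk.
  rewrite !quot_or00 !quot_or_fin // inve1 mule1 mule0 addye //.
  rewrite pinfty_mul_fin ?divr_gt0 // !fin_mul_pinfty // leey.
  rewrite -EFinD -!EFinM pinfty_div_fin ?mulr_gt0 ?addr_gt0 //.
  rewrite EFin_div ?mulr_gt0 // !ltry lee_fin.
  have -> : (1 <= T2 / T1 * (value v2 (rightq n k) / value v1 (rightq n k))) =
            (T1 * value v1 (rightq n k) <= T2 * value v2 (rightq n k)).
    by rewrite mulrACA -invfM ler_pdivlMr ?mulr_gt0 // mul1r.
  split=> [[mu1 [mu2 [_ [_ h] _ _ [m1 _]]]]|[_ _ h _]].
    split => //; apply: le_trans h; rewrite ler_pM2r // -[leLHS]mul1r.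
    by rewrite ler_pM2r.
  (* Bidder 1 wins nothing, so [mu2] has no upper bound. The summands are its lower bounds from
     (vi), (i) and (iv), and the sum of these positive numbers exceeds each of them. *)
  exists 1, (1 + T1 * v1 j / (T2 * v2 j)
    + T1 * value v1 (leftq n j.+1) / (T2 * value v2 (leftq n j.+1))).
  set x := T1 * v1 j / _; set y := _ / _.
  have x0 : 0 < x by rewrite divr_gt0 ?mulr_gt0.
  have y0 : 0 < y by rewrite divr_gt0 ?mulr_gt0.
  rewrite (forall_val_eq _ jk) (forall_succ_eq0 _ k0).
  rewrite (forall_val_eq _ jk) (forall_succ_eq0 _ k0).
  split=> //; last by split=> //; lra.
  + split=> //; rewrite mul1r -mulrA -ltr_pdivrMr ?mulr_gt0 // -/x; lra.
  + by rewrite !mulr0 lexx mul1r.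
  + by rewrite -mulrA -ltr_pdivrMr ?mulr_gt0 // -/y; lra.
- have A0 : 0 < value v1 (leftq n k)
    by apply: (@value_gt0 _ _ _ _ i); rewrite // inE -ik.
  have B0 : 0 < value v2 (leftq n k)
    by apply: (@value_gt0 _ _ _ _ i); rewrite // inE -ik.
  have C0 : 0 < value v1 (rightq n i)
    by apply: (@value_gt0 _ _ _ _ i); rewrite // inE.
  have D0 : 0 < value v2 (rightq n i)
    by apply: (@value_gt0 _ _ _ _ i); rewrite // inE.
  rewrite !(extend_succ _ _ _ ik) !(VR_succ _ _ _ ik).
  have VLk (x0 xlast : \bar R) v :
      VL (extend x0 xlast v) k.+1 = ((value v (leftq n k))%:E + xlast)%E.
    by rewrite kn VL_last.
  have xk (x0 xlast : \bar R) (v : 'I_n -> R) : extend x0 xlast v k.+1 = xlast.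
    by rewrite kn extend_last.
  have Vk v : value v (rightq n k) = 0 by rewrite kn rightqn value_set0.
  rewrite !VLk !xk !Vk !quot_or00 !quot_or_fin // invey addey //.
  rewrite !fin_mul_pinfty // invey !mule0 mul0e leey -!EFinM.
  rewrite !EFin_div ?mulr_gt0 //.
  rewrite fin_mul_pinfty ?divr_gt0 // ltry lte_fin divr_gt0 ?mulr_gt0 //.
  rewrite lee_fin.
  have -> : (1 <= T1 / T2 * (value v1 (leftq n k) / value v2 (leftq n k))) =
            (T2 * value v2 (leftq n k) <= T1 * value v1 (leftq n k)).
    by rewrite mulrACA -invfM ler_pdivlMr ?mulr_gt0 // mul1r.
  split=> [[mu1 [mu2 [_ [h _] _ _ [_ m2]]]]|[_ _ _ h]].
    split => //; apply: le_trans h; rewrite ler_pM2r // -[leLHS]mul1r.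
    by rewrite ler_pM2r.
  (* Here [mu1] has no upper bound; the summands are its lower bounds from (vi), (i) and (v). *)
  exists (1 + T2 * v2 i / (T1 * v1 i)
    + T2 * value v2 (rightq n i) / (T1 * value v1 (rightq n i))), 1.
  set x := T2 * v2 i / _; set y := _ / _.
  have x0 : 0 < x by rewrite divr_gt0 ?mulr_gt0.
  have y0 : 0 < y by rewrite divr_gt0 ?mulr_gt0.
  rewrite (forall_val_eqn _ kn) (forall_succ_eq _ ik).
  rewrite (forall_val_eqn _ kn) (forall_succ_eq _ ik).
  split=> //; last by split=> //; lra.
  + split=> //; rewrite mul1r -mulrA -ler_pdivrMr ?mulr_gt0 // -/x; lra.
  + by rewrite !mulr0 lexx mul1r.
  + by rewrite -mulrA -ltr_pdivrMr ?mulr_gt0 // -/y; lra.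
- have C0 : 0 < value v1 (rightq n k)
    by apply: (@value_gt0 _ _ _ _ j); rewrite // inE jk.
  have D0 : 0 < value v2 (rightq n k)
    by apply: (@value_gt0 _ _ _ _ j); rewrite // inE jk.
  have A0 : 0 < value v1 (leftq n k)
    by apply: (@value_gt0 _ _ _ _ i); rewrite // inE -ik.
  have B0 : 0 < value v2 (leftq n k)
    by apply: (@value_gt0 _ _ _ _ i); rewrite // inE -ik.
  rewrite !(extend_succ _ _ _ ik) !(VR_succ _ _ _ ik).
  rewrite !(extend_val _ _ _ jk) !(VL_val _ _ _ jk).
  rewrite !quot_or_fin // -!EFinM.
  rewrite !value_leftqS !value_rightqS ik jk.
  rewrite !EFin_div ?mulr_gt0 ?addr_gt0 // -!EFinM !lte_fin !lee_fin.
  have hij : v1 j * v2 i < v1 i * v2 j.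
    have : v1 j / v2 j < v1 i / v2 i by apply: hord; rewrite -ltnS ik jk.
    by rewrite ltr_pdivrMr // mulrAC ltr_pdivlMr.
  have := interior_multipliers hT1 hT2 (hv1 i) (hv2 i) (hv1 j) (hv2 j)
    A0 B0 C0 D0 hij.
  case.
  (* Query $k$ has the least ratio in $L_k$; the cross-multiplied comparisons are summed over $L_k$.
     The next goal does the same on $R_{k+1}$, where query $k+1$ has the greatest ratio. *)
  + rewrite /value mulr_sumr mulr_suml; apply: ler_sum => i'.
    rewrite inE -ik ltnS => /(ratio12_le hord).
    by rewrite ler_pdivrMr // mulrAC ler_pdivlMr.
  + rewrite /value mulr_sumr mulr_suml; apply: ler_sum => i'.
    rewrite inE -jk => /(ratio12_le hord).
    by rewrite ler_pdivrMr // mulrAC ler_pdivlMr.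
  move=> h1 h2; split=> [[mu1 [mu2 h]]|/h2 [mu1 [mu2 h]]].
    apply: h1; exists mu1, mu2; move: h.
    rewrite !(forall_succ_eq _ ik) !(forall_val_eq _ jk).
    by rewrite !value_leftqS !value_rightqS ik jk.
  exists mu1, mu2; move: h.
  rewrite !(forall_succ_eq _ ik) !(forall_val_eq _ jk).
  by rewrite !value_leftqS !value_rightqS ik jk.
Qed.

End ExtendedReals.


Theorem theorem3 (R : realType) (n : nat) (T1 T2 : R) (v1 v2 : 'I_n -> R)
    (k : nat)
    (hn : (1 <= n)%N) (hk : (k <= n)%N)
    (hT1 : 0 < T1) (hT2 : 0 < T2)
    (hv1 : forall i, 0 < v1 i) (hv2 : forall i, 0 < v2 i)
    (hord : forall i j : 'I_n, (i < j)%N -> v1 j / v2 j < v1 i / v2 i) :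
  let x1 := xv1 v1 in
  let x2 := xv2 v2 in
  let four_inequalities :=
    [/\ (T1%:E * VL x1 k.+1) / (T2%:E * VL x2 k.+1)
          < (x1 k / x2 k) * quot_or +oo (VR n x2 k.+1) (VR n x1 k.+1),
        (T1%:E * VR n x1 k) / (T2%:E * VR n x2 k)
          > (x1 k.+1 / x2 k.+1) * quot_or 0 (VL x2 k) (VL x1 k),
        (T2 / T1)%:E * quot_or +oo (VR n x2 k.+1) (VR n x1 k.+1) >= 1 &
        (T1 / T2)%:E * quot_or +oo (VL x1 k) (VL x2 k) >= 1]%E in
  ((exists mu1 mu2 : R, autobidder_equilibrium T1 T2 v1 v2 mu1 mu2 /\
                        allocation_N k T1 T2 v1 v2 mu1 mu2)
     <-> four_inequalities) /\
  ((exists mu1 mu2 : R, multiplier_inequalities k T1 T2 v1 v2 mu1 mu2)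
     <-> four_inequalities).
Proof.
move=> x1 x2 four; have h := exists_real_four hn hk hT1 hT2 hv1 hv2 hord.
(* Both existence claims pass through [real_inequalities] with the same multipliers. *)
split; apply: iff_trans h; split=> -[mu1 [mu2 h]]; exists mu1, mu2.
- exact/(equilibrium_real hk hT1 hT2 hv1 hv2 hord).
- exact/(equilibrium_real hk hT1 hT2 hv1 hv2 hord).
- exact/multiplier_real.
- exact/multiplier_real.
Qed.
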